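(* Let $\pi \in \mathfrak{S}_n$ and $D \subseteq [n - 1]$ be such that $\operatorname{ls}_D(\pi) \neq 0$. If $D = \varnothing$, then $\operatorname{ls}_D(\pi) = \operatorname{is}(\pi)$. Otherwise, $$\operatorname{ls}_D(\pi) = m + \operatorname{ls}_{D'}(\pi_{[k, n]}),$$ where $D' = \{i - m : i \in D \setminus [m]\}$ and - if $1 \in D$, then $m$ is the smallest positive integer such that $m + 1 \notin D$, and $k$ is the smallest index such that $\operatorname{ds}(\pi_{[k]}) = m + 1$; - if $1 \notin D$, then $m = \min D - 1$, and $k$ is the smallest index such that $\operatorname{is}(\pi_{[k]}) = m + 1$.
   Context: $\mathfrak{S}_n$ is the set of permutations of $[n]=\{1,\dots,n\}$. For $I=\{i_1<\cdots<i_r\}\subseteq[n]$, $\pi_I=\pi(i_1)\cdots\pi(i_r)$, so $\pi_{[k]}=\pi(1)\cdots\pi(k)$ and $\pi_{[k,n]}=\pi(k)\cdots\pi(n)$. For a sequence $\sigma$ of distinct numbers, $\operatorname{is}(\sigma)$ and $\operatorname{ds}(\sigma)$ are the lengths of a longest increasing, respectively decreasing, subsequence of $\sigma$. The descent set of a sequence $\sigma$ of length $r$ is $\operatorname{Des}(\sigma)=\{j\in[r-1] : \sigma(j)>\sigma(j+1)\}$. For a set $D$ of positive integers, $\operatorname{ls}_D(\sigma)$ is the maximum length of a subsequence of $\sigma$ whose descent set is exactly $D$ (equal to $0$ if there is none). *)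

(* Defs.v *)
From HB Require Import structures.
From mathcomp Require Import all_boot all_fingroup.
From mathcomp Require Import finmap.

Set Implicit Arguments.
Unset Strict Implicit.
Unset Printing Implicit Defensive.

Local Open Scope fset_scope.

(* Positions and values of a permutation of [n] are 'I_n, i.e. 0-based: the
   ordinal i stands for i.+1.  All the natural numbers below are 1-based. *)

(* The integer interval {a, ..., b}, intersected with [n]. *)
Definition ord_itv (n a b : nat) : {set 'I_n} :=
  [set i : 'I_n | a <= i.+1 <= b].

(* The word pi_I; enum lists I in increasing order. *)
Definition restr_word (n : nat) (pi : 'S_n) (I : {set 'I_n}) : seq nat :=
  [seq (pi i).+1 | i <- enum I].

Definition perm_word (n : nat) (pi : 'S_n) : seq nat :=
  restr_word pi [set: 'I_n].

(* The subsequences of s are the mask b s with b of length size s. *)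
Definition lis (s : seq nat) : nat :=
  \max_(b : (size s).-tuple bool | sorted ltn (mask b s)) size (mask b s).

Definition lds (s : seq nat) : nat :=
  \max_(b : (size s).-tuple bool | sorted gtn (mask b s)) size (mask b s).

(* nth is 0-based, so s(j) is nth 0 s j.-1 and s(j + 1) is nth 0 s j. *)
Definition Des (s : seq nat) : {fset nat} :=
  [fset j in iota 1 (size s).-1 | nth 0 s j.-1 > nth 0 s j].

(* An empty \max is 0. *)
Definition ls (D : {fset nat}) (s : seq nat) : nat :=
  \max_(b : (size s).-tuple bool | Des (mask b s) == D) size (mask b s).

Definition least (P : nat -> Prop) (x : nat) : Prop :=
  P x /\ forall y, P y -> x <= y.

Definition shift_down (m : nat) (D : {fset nat}) : {fset nat} :=
  [fset (i - m)%N | i in D `\` [fset j in iota 1 m]].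

(* Main.v *)
Require Import Defs.
From HB Require Import structures.
From mathcomp Require Import all_boot all_fingroup.
From mathcomp Require Import finmap.

Set Implicit Arguments.
Unset Strict Implicit.
Unset Printing Implicit Defensive.

(** Both cases of the recursion are one statement about a word [w] and a
    direction [c].  The set [D] asks for [m] steps in direction [c] followed,
    if anything follows, by a step in the other direction; [k] is the shortest
    length of a prefix of [w] that contains a [c]-monotone subsequence of
    length [m.+1].

    Upper bound: in a subsequence with descent set [D], the first [m.+1]
    letters are [c]-monotone, so the last of them sits at position [k] or
    later ([subseq_cat_cons]); dropping the first [m] letters leaves a
    subsequence of the suffix that starts at [k], with descent set
    [shift_down m D].

    Lower bound: by minimality of [k], a [c]-monotone [a] of length [m]
    followed by the [k]-th letter [x] is [c]-monotone in the prefix.  Let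
    [y, z, ...] be an optimal subsequence of the suffix; its first step is not
    in direction [c].  If [x, z] is not in direction [c] either, [x] may
    replace [y].  Otherwise [x, z] is in direction [c] and [y, z] is not, so
    [x, y] is in direction [c] ([step_transN]) and [a, y] is [c]-monotone by
    transitivity.  Either way [a] may be
    prepended to a subsequence of optimal length ([exchange_head]).

    [Des_split] translates between descent sets and this cut into a monotone
    part and a remainder.  For empty [D] there is no step down at all, and a
    subsequence of a permutation is then increasing ([Des_eq0]). *)

(** * Longest subsequences with a property *)

Definition longest (P : pred (seq nat)) (s : seq nat) : nat :=
  \max_(b : (size s).-tuple bool | P (mask b s)) size (mask b s).

Lemma longest_ge (P : pred (seq nat)) s t :
  subseq t s -> P t -> size t <= longest P s.
Proof.
case/subseqP=> b /eqP size_b -> Pb.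
exact: (leq_bigmax_cond (Tuple size_b)
          (F := fun b : (size s).-tuple bool => size (mask b s))).
Qed.

Lemma longest_le (P : pred (seq nat)) s N :
  (forall t, subseq t s -> P t -> size t <= N) -> longest P s <= N.
Proof. by move=> le_N; apply/bigmax_leqP => b; apply/le_N/mask_subseq. Qed.

Lemma longest_attained (P : pred (seq nat)) s : longest P s <> 0 ->
  exists t, [/\ subseq t s, P t & size t = longest P s].
Proof.
move=> nz; case: (pickP (fun b : (size s).-tuple bool => P (mask b s))).
- move=> b0 Pb0.
  pose F := fun b : (size s).-tuple bool => size (mask b s).
  have [|b Pb maxE] :=
      @eq_bigmax_cond _ [pred b : (size s).-tuple bool | P (mask b s)] F.
    by apply/card_gt0P; exists b0.
  by exists (mask b s); split; rewrite // mask_subseq.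
- by move=> P0; case: nz; rewrite /longest big_pred0.
Qed.

Lemma eq_longest (P Q : pred (seq nat)) s :
  (forall t, subseq t s -> P t = Q t) -> longest P s = longest Q s.
Proof. by move=> PQ; apply: eq_bigl => b; apply/PQ/mask_subseq. Qed.

Lemma ls_ge D s t : subseq t s -> Des t == D -> size t <= ls D s.
Proof. exact: (@longest_ge [pred t | Des t == D]). Qed.

Lemma ls_le D s N :
  (forall t, subseq t s -> Des t == D -> size t <= N) -> ls D s <= N.
Proof. exact: (@longest_le [pred t | Des t == D]). Qed.

Lemma ls_attained D s : ls D s <> 0 ->
  exists t, [/\ subseq t s, Des t == D & size t = ls D s].
Proof. exact: (@longest_attained [pred t | Des t == D]). Qed.

(** * Cutting subsequences *)

Lemma subseq_rcons_split (t s : seq nat) x : subseq t (rcons s x) ->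
  subseq t s \/ exists2 t', t = rcons t' x & subseq t' s.
Proof.
case/subseqP=> b; case/lastP: b => [|b e]; first by rewrite size_rcons.
rewrite !size_rcons => -[size_b] ->; rewrite mask_rcons //.
case: e => /=; last by rewrite cats0; left; apply: mask_subseq.
by rewrite cats1; right; exists (mask b s); rewrite ?mask_subseq.
Qed.

(** Locates the letter [x] at an index of [w], so that the part of the
    subsequence up to [x] and the part after it can be bounded separately. *)
Lemma subseq_cat_cons (u v w : seq nat) x : subseq (u ++ x :: v) w ->
  exists w1 w2, [/\ w = w1 ++ x :: w2, subseq u w1 & subseq v w2].
Proof.
elim: w u => [|y w IHw] u; first by case: u.
case: u => [|z u] /=; case: eqP => [->|neq] sub_w.
- by exists [::], w; rewrite sub0seq.
- have [w1 [w2 [-> _ sub2]]] := IHw [::] sub_w.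
  by exists (y :: w1), w2; rewrite sub0seq.
- have [w1 [w2 [-> sub1 sub2]]] := IHw u sub_w.
  by exists (y :: w1), w2; rewrite /= eqxx.
- have [w1 [w2 [-> sub1 sub2]]] := IHw (z :: u) sub_w.
  by exists (y :: w1), w2; split=> //; apply: subseq_trans (subseq_cons _ _).
Qed.

(** * Steps in a given direction *)

(** The direction [true] is a strict descent and [false] a weak ascent, so
    that the two are complementary on all pairs, and ascents are strict on
    words without repetition. *)
Definition step (c : bool) : rel nat := fun x y => (y < x) == c.

Lemma step_trans c : transitive (step c).
Proof.
case: c => y x z; rewrite /step ?eqb_id ?eqbF_neg -?leqNgt => le_xy le_yz.
- exact: ltn_trans le_yz le_xy.
- exact: leq_trans le_xy le_yz.
Qed.

(** The negation of [step c] is the weak or strict form of the opposite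
    direction; mixing it with [step c] always keeps the strictness that
    [step c] requires, so equal letters need no separate treatment. *)
Lemma step_transN c x y z : step c x z -> ~~ step c y z -> step c x y.
Proof.
case: c; rewrite /step ?eqb_id ?eqbF_neg ?negbK -?leqNgt => lt_xz lt_yz.
- exact: leq_ltn_trans lt_yz lt_xz.
- exact: leq_trans lt_xz (ltnW lt_yz).
Qed.

Lemma sorted_step_false t : uniq t -> sorted (step false) t = sorted ltn t.
Proof.
move=> uniq_t; rewrite ltn_sorted_uniq_leq uniq_t /=.
by apply: eq_sorted => x y; rewrite /step eqbF_neg -leqNgt.
Qed.

Lemma lisE s : uniq s -> lis s = longest (sorted (step false)) s.
Proof.
move=> uniq_s; apply: (@eq_longest (sorted ltn)) => t sub_t.
by rewrite sorted_step_false // (subseq_uniq sub_t).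
Qed.

Lemma ldsE s : lds s = longest (sorted (step true)) s.
Proof.
apply: (@eq_longest (sorted gtn)) => t _.
by apply: eq_sorted => x y; rewrite /step eqb_id.
Qed.

(** * Descent sets *)

Lemma in_Des s i :
  (i \in Des s) = (0 < i < size s) && (nth 0 s i < nth 0 s i.-1).
Proof.
rewrite /Des !inE mem_iota add1n; case: i => //= i.
by case: (size s).
Qed.

Lemma in_shift_down m D i : 0 \notin D ->
  (i \in shift_down m D) = (0 < i) && (m + i \in D).
Proof.
move=> D0; apply/imfsetP/andP => /= [[j]|[i_gt0 Dmi]].
- rewrite !inE mem_iota add1n ltnS => /andP[jm Dj] ->.
  have j_gt0 : 0 < j by case: j Dj {jm} => // D0'; rewrite D0' in D0.
  rewrite j_gt0 -ltnNge in jm.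
  by rewrite subn_gt0 jm subnKC // ltnW.
- exists (m + i); last by rewrite addKn.
  have lt_m : m < m + i by rewrite -addn1 leq_add2l.
  by rewrite !inE mem_iota Dmi andbT add1n ltnS [m + i <= m]leqNgt lt_m andbF.
Qed.

(** Shifting by [m] is what deleting the first [m] letters does to the descents
    after position [m]; the descents up to [m] only say that the first [m.+1]
    letters go in direction [c]. *)
Lemma Des_split c m D t :
    0 \notin D -> (forall i, 0 < i <= m -> (i \in D) = c) -> m < size t ->
  (Des t == D) =
    sorted (step c) (take m.+1 t) && (Des (drop m t) == shift_down m D).
Proof.
move=> D0 Dc lt_mt; apply/eqP/andP => [DesD|[/(sortedP 0) t_c /eqP t_D]].
- split.
  + apply/(sortedP 0) => i; rewrite size_takel // ltnS => lt_im.
    rewrite !nth_take //; last exact: ltnW.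
    have := in_Des t i.+1; rewrite DesD Dc //= => ->.
    by rewrite (leq_ltn_trans lt_im lt_mt) /step /=.
  + apply/eqP/fsetP => i; rewrite in_shift_down // -DesD !in_Des size_drop.
    case: i => // i /=; rewrite !nth_drop addnS /= -addnS ltn_subRL addnS.
    by [].
- apply/fsetP => i; rewrite in_Des.
  case: (posnP i) => [->|i_gt0] /=; first by rewrite (negPf D0).
  have [le_im|lt_mi] := leqP i m.
  + rewrite Dc ?i_gt0 // (leq_ltn_trans le_im lt_mt) /=.
    case: i i_gt0 le_im => // i _ lt_im.
    have := t_c i; rewrite size_takel // ltnS => /(_ lt_im).
    by rewrite /step !nth_take // => [/eqP|]; last exact: ltnW.
  + have := in_Des (drop m t) (i - m).
    rewrite t_D in_shift_down // subn_gt0 lt_mi /= size_drop !nth_drop.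
    case: i {i_gt0} lt_mi => // i; rewrite ltnS => le_mi.
    rewrite subSn //= addnS subnKC // => ->; congr (_ && _).
    by rewrite -subSn // ltn_sub2rE // ltnW.
Qed.

Lemma Des_eq0 t : (Des t == fset0) = sorted (step false) t.
Proof.
apply/eqP/(sortedP 0) => [Des0 i lt_it|t_inc].
- by have := in_Des t i.+1; rewrite Des0 inE lt_it /step => /= <-.
- apply/fsetP => -[|i]; rewrite in_Des inE //=; apply/negP => /andP[lt_it].
  by have := t_inc i lt_it; rewrite /step => /eqP /= ->.
Qed.

(** * The recursion on words *)

(** The new head of the remainder is [x] if this keeps its first step outside
    direction [c], and the old head [y] otherwise; transitivity makes the
    second choice compatible with [a]. *)
Lemma exchange_head c a x y t :
    sorted (step c) (rcons a x) -> (0 < size t -> ~~ step c y (head 0 t)) ->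
  exists z, [/\ z = x \/ z = y, sorted (step c) (rcons a z)
              & Des (z :: t) = Des (y :: t)].
Proof.
move=> ax_c; case: t => [|t1 t] /= => [_|/(_ isT) Nyt1].
  by exists x; split=> //; [left | apply/fsetP => -[|i]; rewrite !in_Des].
have [xt1|Nxt1] := boolP (step c x t1).
  exists y; split=> //; first by right.
  have xy := step_transN xt1 Nyt1.
  case: a ax_c => //= a0 a; rewrite !rcons_path => /andP[-> ax] /=.
  exact: step_trans ax xy.
exists x; split=> //; first by left.
apply/fsetP => -[|[|i]]; rewrite !in_Des //=.
by move: Nxt1 Nyt1; rewrite /step; do 2 case: (_ < _); case: (c).
Qed.

(** A shortest prefix in which length [m.+1] is reached has longest monotone
    length exactly [m.+1], because one more letter lengthens a subsequence by
    at most one; and that last letter must be used. *)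
Lemma first_monotone c m w : m < longest (sorted (step c)) w ->
  exists k, [/\ k < size w, longest (sorted (step c)) (take k.+1 w) = m.+1,
    forall j, m < longest (sorted (step c)) (take j w) -> k < j
    & exists a, [/\ size a = m, subseq a (take k w)
                  & sorted (step c) (rcons a (nth 0 w k))]].
Proof.
move=> lt_mw; have ex_k: exists k, m < longest (sorted (step c)) (take k w).
  by exists (size w); rewrite take_size.
case: (ex_minnP ex_k) => -[|k]; rewrite ?take0 => lt_mk min_k.
  have : longest (sorted (step c)) [::] <= 0.
    by apply: longest_le => t; rewrite subseq0 => /eqP ->.
  by move/(leq_trans lt_mk).
have lt_kw : k < size w.
  rewrite ltnNge; apply/negP => le_wk.
  by have := min_k k; rewrite ltnn take_oversize // => /(_ lt_mw).
have le_km : longest (sorted (step c)) (take k w) <= m.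
  by rewrite leqNgt; apply/negP => /min_k; rewrite ltnn.
(* a subsequence longer than [m] must use the last letter of the prefix *)
have ends t : subseq t (take k.+1 w) -> sorted (step c) t -> m < size t ->
    exists2 a, t = rcons a (nth 0 w k) & subseq a (take k w).
  rewrite (take_nth 0) // => /subseq_rcons_split[sub_t t_c|//] lt_mt.
  have := leq_trans lt_mt (longest_ge sub_t t_c).
  by rewrite ltnNge le_km.
have kE : longest (sorted (step c)) (take k.+1 w) = m.+1.
  apply/eqP; rewrite eqn_leq lt_mk andbT; apply: longest_le => t sub_t t_c.
  rewrite leqNgt; apply/negP => lt_mt.
  have [a tE sub_a] := ends t sub_t t_c (ltnW lt_mt).
  have a_c : sorted (step c) a.
    by apply: subseq_sorted t_c; [apply: step_trans | rewrite tE subseq_rcons].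
  have := leq_trans (longest_ge sub_a a_c) le_km.
  by rewrite leqNgt; move: lt_mt; rewrite tE size_rcons ltnS => ->.
have [|t [sub_t t_c]] := @longest_attained (sorted (step c)) (take k.+1 w).
  by rewrite kE.
rewrite kE => size_t; have [|a tE sub_a] := ends t sub_t t_c.
  by rewrite size_t.
exists k; split=> //; exists a; split=> //; last by rewrite -tE.
by move: size_t; rewrite tE size_rcons => -[].
Qed.

(** The common form of both cases: [D] starts with a run of [m] steps in
    direction [c] and asks for the other direction at [m.+1].  For
    [c = true] that step may be missing altogether; an element of [D] that
    is at least [m] makes every word with descent set [D] long enough to
    complete the run. *)
Lemma ls_recursion c m D w :
    0 \notin D -> (forall i, 0 < i <= m -> (i \in D) = c) ->
    (m.+1 \in D) = ~~ c -> (exists2 d, d \in D & m <= d) -> ls D w <> 0 ->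
  exists k, [/\ 0 < k <= size w,
    longest (sorted (step c)) (take k w) = m.+1,
    forall j, longest (sorted (step c)) (take j w) = m.+1 -> k <= j
    & ls D w = m + ls (shift_down m D) (drop k.-1 w)].
Proof.
move=> D0 Dc Dm1 [d Dd le_md] ls_neq0.
have lt_mt t : Des t == D -> m < size t.
  move=> /eqP DesD; move: Dd; rewrite -DesD in_Des => /andP[/andP[_ lt_dt] _].
  exact: leq_ltn_trans lt_dt.
have [t [sub_t DesD _]] := ls_attained ls_neq0.
have lt_mw : m < longest (sorted (step c)) w.
  have lt_m := lt_mt t DesD.
  move: (DesD); rewrite (Des_split D0 Dc lt_m) => /andP[t_c _].
  rewrite -[m.+1](size_takel lt_m); apply: longest_ge t_c.
  exact: subseq_trans (take_subseq _ _) sub_t.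
have [k [lt_kw kE min_k [a [size_a sub_a ax_c]]]] := first_monotone lt_mw.
(* besides the bound, the suffix must contain a nonempty subsequence with the
   shifted descent set for the exchange below to have a head to act on *)
have upper u : subseq u w -> Des u == D ->
    size u <= m + ls (shift_down m D) (drop k w) /\
    0 < ls (shift_down m D) (drop k w).
  move=> sub_u DesuD; have lt_mu := lt_mt u DesuD.
  move: DesuD; rewrite (Des_split D0 Dc lt_mu) => /andP[u_c u_D].
  have suff_u : subseq (drop m u) (drop k w).
    move: sub_u; rewrite -{1}(cat_take_drop m u) (drop_nth 0 lt_mu).
    case/subseq_cat_cons=> w1 [w2 [wE sub1 sub2]].
    (* the monotone part of [u] ends at index [size w1] of [w] *)
    have le_kw1 : k <= size w1.
      rewrite -ltnS; apply: min_k; rewrite -[m.+1](size_takel lt_mu).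
      apply: longest_ge u_c; rewrite (take_nth 0) // wE -cat_rcons.
      rewrite take_size_cat ?size_rcons // -!cats1.
      by rewrite cat_subseq.
    rewrite wE drop_cat ltn_neqAle le_kw1 andbT.
    case: eqP => /= [->|_]; first by rewrite subnn drop0 /= eqxx.
    by apply: subseq_trans (suffix_subseq _ _); rewrite /= eqxx.
  have := ls_ge suff_u u_D; rewrite size_drop => le_u.
  split; first by rewrite -leq_subLR.
  by apply: leq_trans le_u; rewrite subn_gt0.
have [_ pos] := upper t sub_t DesD.
exists k.+1; split=> //; first by move=> j jE; apply: min_k; rewrite jE.
apply/eqP; rewrite eqn_leq /=; apply/andP; split.
  by apply: ls_le => u sub_u /(upper u sub_u)[].
have [|v [sub_v v_D size_v]] := @ls_attained (shift_down m D) (drop k w).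
  by move=> ls0; rewrite ls0 in pos.
rewrite -size_v in pos *.
case: v {size_v} pos sub_v v_D => // y v _.
rewrite (drop_nth 0 lt_kw) => sub_v v_D.
have [|z [z_xy az_c zv_D]] := exchange_head (y := y) (t := v) ax_c.
  move=> v_gt0; have := in_Des (y :: v) 1.
  rewrite (eqP v_D) in_shift_down //= addn1 Dm1 ltnS v_gt0 nth0 /= /step => <-.
  by case: (c).
have sub_zv : subseq (z :: v) (nth 0 w k :: drop k.+1 w).
  case: z_xy => -> //; rewrite /= eqxx.
  move: sub_v => /=; case: eqP => // _; apply: subseq_trans.
  exact: subseq_cons.
have size_azv : size a + size (y :: v) = size (a ++ z :: v).
  by rewrite size_cat.
rewrite -{1}size_a size_azv; apply: ls_ge.
- by rewrite -(cat_take_drop k w) cat_subseq // (drop_nth 0 lt_kw).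
- rewrite (@Des_split c m) //; last first.
    by rewrite -size_azv size_a /= addnS ltnS leq_addr.
  rewrite -cat_rcons take_size_cat ?size_rcons ?size_a // az_c cat_rcons.
  by rewrite drop_size_cat // zv_D.
Qed.

(** * Words of permutations *)

Lemma perm_wordE n (pi : 'S_n) :
  perm_word pi = [seq (pi i).+1 | i <- enum 'I_n].
Proof. by congr map; apply: eq_enum => i; rewrite inE. Qed.

Lemma size_perm_word n (pi : 'S_n) : size (perm_word pi) = n.
Proof. by rewrite perm_wordE size_map size_enum_ord. Qed.

Lemma perm_word_uniq n (pi : 'S_n) : uniq (perm_word pi).
Proof.
rewrite perm_wordE map_inj_uniq ?enum_uniq // => i j [ij].
exact/(@perm_inj _ pi)/val_inj.
Qed.

Lemma val_enum_itv n a b :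
  [seq val i | i <- enum (ord_itv n a b)] =
    [seq i <- iota 0 n | a <= i.+1 <= b].
Proof.
rewrite -val_enum_ord filter_map [enum 'I_n]enumT /enum_mem; congr map.
by apply: eq_filter => i; rewrite /= inE.
Qed.

Lemma prefix_word n (pi : 'S_n) j : j <= n ->
  restr_word pi (ord_itv n 1 j) = take j (perm_word pi).
Proof.
move=> le_jn; rewrite perm_wordE -map_take; congr map.
apply: (inj_map val_inj); rewrite map_take val_enum_ord val_enum_itv take_iota.
by rewrite (filter_iota_ltn 0 le_jn) (minn_idPl le_jn).
Qed.

Lemma suffix_word n (pi : 'S_n) k : k < n ->
  restr_word pi (ord_itv n k.+1 n) = drop k (perm_word pi).
Proof.
move=> lt_kn; rewrite perm_wordE -map_drop; congr map.
apply: (inj_map val_inj); rewrite map_drop val_enum_ord val_enum_itv.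
have -> : iota 0 n = iota 0 k ++ iota k (n - k).
  by rewrite -{1}(subnKC (ltnW lt_kn)) iotaD.
rewrite drop_size_cat ?size_iota // filter_cat.
rewrite (@eq_in_filter _ _ pred0 (iota 0 k)) => [|i]; last first.
  by rewrite mem_iota => /andP[_ lt_ik]; rewrite ltnS leqNgt lt_ik.
rewrite filter_pred0; apply/all_filterP/allP => i.
by rewrite mem_iota ltnS subnKC // ltnW.
Qed.

Theorem proposition4p11 (n : nat) (pi : 'S_n) (D : {fset nat})
    (D_sub : forall i : nat, i \in D -> 1 <= i <= n - 1)
    (ls_neq0 : ls D (perm_word pi) <> 0) :
  (D = fset0 -> ls D (perm_word pi) = lis (perm_word pi)) /\
  (D <> fset0 ->
    exists m k : nat,
      [/\ 1 \in D ->
            least (fun i => 1 <= i /\ i.+1 \notin D) m /\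
            least (fun j => 1 <= j <= n /\
                     lds (restr_word pi (ord_itv n 1 j)) = m.+1) k,
          1 \notin D ->
            (exists2 d, least (fun i => i \in D) d & m = d - 1) /\
            least (fun j => 1 <= j <= n /\
                     lis (restr_word pi (ord_itv n 1 j)) = m.+1) k
        & ls D (perm_word pi) =
          m + ls (shift_down m D) (restr_word pi (ord_itv n k n))]).
Proof.
split=> [D0|/eqP/fset0Pn[d0 Dd0]].
  rewrite lisE ?perm_word_uniq // D0.
  by apply: (@eq_longest [pred t | Des t == fset0]) => t _; rewrite /= Des_eq0.
have D0 : 0 \notin D by apply/negP => /D_sub.
have prefixE j : 0 < j <= n ->
    longest (sorted (step (1 \in D))) (take j (perm_word pi)) =
    if 1 \in D then lds (restr_word pi (ord_itv n 1 j))
    else lis (restr_word pi (ord_itv n 1 j)).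
  case/andP=> _ le_jn; rewrite prefix_word // ldsE lisE; first by case: ifP.
  exact: subseq_uniq (take_subseq _ _) (perm_word_uniq pi).
(* the description of [m] in whichever of the two cases applies *)
pose shape m :=
  if 1 \in D then least (fun i => 1 <= i /\ i.+1 \notin D) m
  else exists2 d, least (fun i => i \in D) d & m = d - 1.
have [m [m_shape Dm Dm1 Dge]] : exists m, [/\ shape m,
    forall i, 0 < i <= m -> (i \in D) = (1 \in D), (m.+1 \in D) = (1 \notin D)
    & exists2 d, d \in D & m <= d].
  rewrite /shape; have [D1|ND1] := boolP (1 \in D).
  - have ex_m : exists i, (0 < i) && (i.+1 \notin D).
      exists n; apply/andP; split; first by case: (n) (D_sub 1 D1).
      by apply/negP => /D_sub/andP[_]; rewrite ltnNge leq_subr.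
    case: (ex_minnP ex_m) => m /andP[m_gt0 NDm1] min_m.
    have Dm i : 0 < i <= m -> i \in D.
      case: i => [|[|i]] // lt_im; apply: contraLR lt_im => NDi.
      by rewrite -leqNgt min_m.
    exists m; split=> //.
    + by split=> // y [y_gt0 NDy]; apply: min_m; rewrite y_gt0.
    + exact: negPf.
    + by exists m; rewrite // Dm // m_gt0 leqnn.
  - case: (ex_minnP (ex_intro _ d0 Dd0)) => -[|d] Dd min_d.
      by case: (negP D0).
    exists d; split=> //.
    + by exists d.+1; rewrite ?subn1.
    + move=> i /andP[_ le_id]; apply: contraTF le_id => /min_d.
      by rewrite -ltnNge.
    + by exists d.+1.
have [k [k_bd kE min_k lsE]] := ls_recursion D0 Dm Dm1 Dge ls_neq0.
rewrite size_perm_word in k_bd.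
rewrite prefixE // in kE; rewrite /shape in m_shape.
exists m, k; split=> [D1|/negPf ND1|].
- rewrite D1 in m_shape kE; split=> //; split=> // j [j_bd jE].
  by apply: min_k; rewrite prefixE // D1.
- rewrite ND1 in m_shape kE; split=> //; split=> // j [j_bd jE].
  by apply: min_k; rewrite prefixE // ND1.
- by case: k k_bd {kE min_k} lsE => // k k_bd ->; rewrite suffix_word.
Qed.
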